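(* Let $(\Sigma_1,\mathcal L_1,\xi_1,\kappa_1)$ and $(\Sigma_2,\mathcal L_2,\xi_2,\kappa_2)$ be two state property systems whose property lattices $\mathcal L_1$ and $\mathcal L_2$ are atomistic, and let $(\Sigma_1\times\Sigma_2,\ \mathcal L_1\coprod\mathcal L_2,\ \xi,\ \kappa)$ be the state property system of their minimal compound entity (the co-product, defined in the context). If the property lattice $\mathcal L_1\coprod\mathcal L_2$ satisfies the covering law, then at least one of the two lattices $\mathcal L_1$, $\mathcal L_2$ is trivial, i.e. consists only of its minimal and its maximal element: $\mathcal L_1=\{0_1,I_1\}$ or $\mathcal L_2=\{0_2,I_2\}$.
   Context: A state property space $(\Sigma,\mathcal L,\xi,\kappa)$ consists of two sets $\Sigma$ (states) and $\mathcal L$ (properties) and two functions $\xi:\Sigma\to\mathcal P(\mathcal L)$ and $\kappa:\mathcal L\to\mathcal P(\Sigma)$ such that $a\in\xi(p)\Leftrightarrow p\in\kappa(a)$ for all $p\in\Sigma$, $a\in\mathcal L$. On $\mathcal L$ one defines $a\prec b\Leftrightarrow\kappa(a)\subset\kappa(b)$, and on $\Sigma$ one defines $p\prec q\Leftrightarrow\xi(q)\subset\xi(p)$ (inclusions not necessarily strict). A state property space is a state property system if $(\mathcal L,\prec)$ is a complete lattice (a partially ordered set in which every subset has an infimum $\wedge$ and a supremum $\vee$), with minimal element $0$ and maximal element $I$, and for all $p\in\Sigma$ and all families $(a_i)_i$ in $\mathcal L$: $I\in\xi(p)$, $0\notin\xi(p)$, and ($a_i\in\xi(p)$ for all $i$)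 $\Leftrightarrow\wedge_i a_i\in\xi(p)$. An atom of a complete lattice $\mathcal L$ is an element $c\neq 0$ such that $y\prec c$ implies $y=c$ or $y=0$. A complete lattice is atomistic if every element $a$ equals the supremum of the atoms $c$ with $c\prec a$. A complete lattice $\mathcal L$ satisfies the covering law if for every atom $c$ and all $a,b\in\mathcal L$ with $a\wedge c=0$ and $a\prec b\prec a\vee c$ one has $a=b$ or $b=a\vee c$. Minimal compound entity (co-product). Given two state property systems as in the claim, with minimal elements $0_1,0_2$ and maximal elements $I_1,I_2$ of $\mathcal L_1,\mathcal L_2$, the set of states is the cartesian product $\Sigma_1\times\Sigma_2$ and $$\mathcal L_1\coprod\mathcal L_2=\{(a_1,a_2)\mid a_1\in\mathcal L_1,\ a_2\in\mathcal L_2,\ a_1\neq 0_1,\ a_2\neq 0_2\}\cup\{0\},$$ ordered by $(a_1,a_2)\prec(b_1,b_2)\Leftrightarrow a_1\prec b_1$ and $a_2\prec b_2$, and $0\prec(a_1,a_2)$ for all $(a_1,a_2)$. Infima are given by $\wedge_i(a_1^i,a_2^i)=(\wedge_i a_1^i,\wedge_i a_2^i)$ if $\wedge_i a_1^i\neq 0_1$ and $\wedge_i a_2^i\neq 0_2$, and $\wedge_i(a_1^i,a_2^i)=0$ otherwise. Moreover $\xi(p_1,p_2)=\{(a_1,a_2)\mid a_1\in\xi_1(p_1),\ a_2\in\xi_2(p_2)\}$ and $\kappa(a_1,a_2)=\{(p_1,p_2)\mid p_1\in\kappa_1(a_1),\ p_2\in\kappa_2(a_2)\}$, $\kappa(0)=\emptyset$.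 *)

(* Defs.v *)
From HB Require Import structures.
From mathcomp Require Import all_boot all_order.
From mathcomp Require Import boolp classical_sets.

Set Implicit Arguments.
Unset Strict Implicit.
Unset Printing Implicit Defensive.

Import Order.Theory.

Local Open Scope classical_set_scope.
Local Open Scope order_scope.

Definition complete_lattice d (L : tbLatticeType d) : Prop :=
  forall A : set L, infimums A !=set0 /\ supremums A !=set0.

Definition atom d (L : tbLatticeType d) (c : L) : Prop :=
  c <> \bot /\ forall y : L, y <= c -> y = c \/ y = \bot.

Definition atomistic d (L : tbLatticeType d) : Prop :=
  forall a : L, supremums [set c : L | atom c /\ c <= a] a.

Definition covering_law d (L : tbLatticeType d) : Prop :=
  forall c a b : L, atom c ->
    a `&` c = \bot -> a <= b -> b <= a `|` c -> a = b \/ b = a `|` c.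

Definition trivial_lattice d (L : tbLatticeType d) : Prop :=
  forall a : L, a = \bot \/ a = \top.

Record sp_space (Sigma L : Type) := SPSpace {
  xi : Sigma -> set L;
  kappa : L -> set Sigma;
  xi_kappa : forall p a, xi p a <-> kappa a p
}.

Definition property_le (Sigma L : Type) (S : sp_space Sigma L) (a b : L) :
  Prop := kappa S a `<=` kappa S b.

(* The order of [properties] is not extra data: [property_leP] forces it to be
   the one induced by [kappa], and [\bot], [\top], [`&`] and [`|`] are
   determined by the order. In [xi_inf] the family is given by its range. *)
Record sp_system d := SPSystem {
  states : Type;
  properties : tbLatticeType d;
  sps_space :> sp_space states properties;
  property_leP : forall a b : properties,
    a <= b <-> property_le sps_space a b;
  properties_complete : complete_lattice properties;
  xi_top : forall p, xi sps_space p \top;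
  xi_bot : forall p, ~ xi sps_space p \bot;
  xi_inf : forall p (A : set properties) (m : properties), infimums A m ->
    (A `<=` xi sps_space p <-> xi sps_space p m)
}.

Arguments states {d} s.
Arguments properties {d} s.
Arguments properties_complete {d} s A.
Arguments xi_top {d} s p.
Arguments xi_bot {d} s p _.

Fact coprod_display : Order.disp_t. Proof. exact: Order.Disp tt tt. Qed.

Section CoproductLattice.
Context (d1 d2 : Order.disp_t) (L1 : tbLatticeType d1) (L2 : tbLatticeType d2).

Definition nzpair := {x : L1 * L2 | (x.1 != \bot) && (x.2 != \bot)}.

(* [None] is the added least element 0. For a pair x, [insub x : coprod] is
   [Some x] if both components are nonzero, and 0 otherwise. *)
Definition coprod := option nzpair.

HB.instance Definition _ := Choice.copy coprod (option nzpair).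

Definition coprod_le (x y : coprod) : bool :=
  match x, y with
  | None, _ => true
  | Some _, None => false
  | Some u, Some v =>
      ((val u).1 <= (val v).1) && ((val u).2 <= (val v).2)
  end.

Definition coprod_meet (x y : coprod) : coprod :=
  match x, y with
  | Some u, Some v =>
      insub ((val u).1 `&` (val v).1, (val u).2 `&` (val v).2)
  | _, _ => None
  end.

Definition coprod_join (x y : coprod) : coprod :=
  match x, y with
  | None, _ => y
  | _, None => x
  | Some u, Some v =>
      insub ((val u).1 `|` (val v).1, (val u).2 `|` (val v).2)
  end.

Fact coprod_le_refl : reflexive coprod_le.
Proof. by case=> [u|] //=; rewrite !lexx. Qed.

Fact coprod_le_anti : antisymmetric coprod_le.
Proof.
case=> [[[u1 u2] pu]|] [[[v1 v2] pv]|] //= /andP[/andP[l1 l2] /andP[g1 g2]].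
congr Some; apply: val_inj => /=.
by congr pair; apply: le_anti; rewrite ?l1 ?l2.
Qed.

Fact coprod_le_trans : transitive coprod_le.
Proof.
case=> [v|] [u|] [w|] //= /andP[l1 l2] /andP[m1 m2].
by rewrite (le_trans l1 m1) (le_trans l2 m2).
Qed.

HB.instance Definition _ := Order.Le_isPOrder.Build coprod_display coprod
  coprod_le_refl coprod_le_anti coprod_le_trans.

Lemma coprod_leE (x y : coprod) : (x <= y) = coprod_le x y.
Proof. by []. Qed.

Lemma coprod_le_insub (u : nzpair) (x : L1 * L2) :
  ((Some u : coprod) <= (insub x : coprod)) =
  ((val u).1 <= x.1) && ((val u).2 <= x.2).
Proof.
rewrite coprod_leE; case: insubP => [v _ <-//|]; rewrite negb_and !negbK /=.
have /andP[/negbTE u1 /negbTE u2] := valP u.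
by case/orP=> /eqP ->; rewrite lex0 ?u1 ?u2 ?andbF.
Qed.

Lemma insub_le_coprod (u : nzpair) (x : L1 * L2) :
    x.1 != \bot -> x.2 != \bot ->
  ((insub x : coprod) <= (Some u : coprod)) =
  (x.1 <= (val u).1) && (x.2 <= (val u).2).
Proof.
move=> x1 x2; rewrite coprod_leE; case: insubP => [v _ <-//|].
by rewrite x1 x2.
Qed.

Fact coprod_lexI (x y z : coprod) :
  (x <= coprod_meet y z) = (x <= y) && (x <= z).
Proof.
case: x => [u|]; last by case: y; case: z.
case: y => [v|]; last by case: z.
case: z => [w|]; last by rewrite andbC.
by rewrite coprod_le_insub !lexI !coprod_leE /= andbACA.
Qed.

Fact coprod_leUx (x y z : coprod) :
  (coprod_join x y <= z) = (x <= z) && (y <= z).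
Proof.
case: x => [u|//]; case: y => [v|]; last by rewrite andbT.
have /andP[u1 u2] := valP u.
have nz d (L : tbLatticeType d) (a b : L) : a != \bot -> a `|` b != \bot.
  by apply: contraNneq => ab0; rewrite -lex0 -ab0 leUl.
case: z => [w|]; last first.
  by rewrite /= !coprod_leE /=; case: insubP => //; rewrite !nz.
by rewrite insub_le_coprod ?nz //= !leUx !coprod_leE /= andbACA.
Qed.

HB.instance Definition _ :=
  Order.POrder_isMeetSemilattice.Build coprod_display coprod coprod_lexI.
HB.instance Definition _ :=
  Order.POrder_isJoinSemilattice.Build coprod_display coprod coprod_leUx.

Fact coprod_le0x (x : coprod) : (None : coprod) <= x.
Proof. by []. Qed.

Fact coprod_lex1 (x : coprod) : x <= (insub (\top, \top) : coprod).
Proof. by case: x => [u|//]; rewrite coprod_le_insub !lex1. Qed.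

HB.instance Definition _ :=
  Order.hasBottom.Build coprod_display coprod coprod_le0x.
HB.instance Definition _ :=
  Order.hasTop.Build coprod_display coprod coprod_lex1.

Definition coprod_fst (A : set coprod) : set L1 :=
  [set a | exists2 u : nzpair, A (Some u) & a = (val u).1].
Definition coprod_snd (A : set coprod) : set L2 :=
  [set a | exists2 u : nzpair, A (Some u) & a = (val u).2].

Lemma coprod_infimums (A : set coprod) m1 m2 : ~ A None ->
  infimums (coprod_fst A) m1 -> infimums (coprod_snd A) m2 ->
  infimums A (insub (m1, m2) : coprod).
Proof.
move=> nA [lb1 glb1] [lb2 glb2]; split=> [[v Av|//]|[v|//] lbv].
  rewrite coprod_leE; case: insubP => [w _ wE|//]; rewrite /= wE /=.
  by apply/andP; split; [apply: lb1|apply: lb2]; exists v.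
rewrite coprod_le_insub; apply/andP; split.
  by apply: glb1 => _ [u Au ->]; have /andP[] := lbv _ Au.
by apply: glb2 => _ [u Au ->]; have /andP[] := lbv _ Au.
Qed.

Lemma coprod_infimums0 (A : set coprod) : A None ->
  infimums A (None : coprod).
Proof. by move=> A0; split=> [x//|x]; apply. Qed.

Lemma coprod_supremums (A : set coprod) m1 m2 (u : nzpair) : A (Some u) ->
  supremums (coprod_fst A) m1 -> supremums (coprod_snd A) m2 ->
  supremums A (insub (m1, m2) : coprod).
Proof.
move=> Au [ub1 lub1] [ub2 lub2]; split=> [[v Av|//]|y uby].
  by rewrite coprod_le_insub; apply/andP; split; [apply: ub1|apply: ub2];
    exists v.
have /andP[u1 u2] := valP u.
have nz d (L : tbLatticeType d) (a b : L) : a != \bot -> a <= b -> b != \bot.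
  by move=> a0 ab; apply: contraNneq a0 => b0; rewrite -lex0 -b0.
case: y uby => [v|] uby; last by have := uby _ Au.
have m1P : m1 != \bot by apply: nz u1 _; apply: ub1; exists u.
have m2P : m2 != \bot by apply: nz u2 _; apply: ub2; exists u.
rewrite insub_le_coprod //; apply/andP; split.
  by apply: lub1 => _ [w Aw ->]; have /andP[] := uby _ Aw.
by apply: lub2 => _ [w Aw ->]; have /andP[] := uby _ Aw.
Qed.

Lemma coprod_complete :
  complete_lattice L1 -> complete_lattice L2 -> complete_lattice coprod.
Proof.
move=> c1 c2 A; have [i1 s1] := c1 (coprod_fst A).
have [i2 s2] := c2 (coprod_snd A); split.
  have [A0|nA] := pselect (A None); first by exists None; apply: coprod_infimums0.
  case: i1 i2 => m1 im1 [m2 im2].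
  by exists (insub (m1, m2)); apply: coprod_infimums.
have [[u Au]|nA] := pselect (exists u : nzpair, A (Some u)).
  case: s1 s2 => m1 sm1 [m2 sm2].
  by exists (insub (m1, m2)); apply: coprod_supremums Au _ _.
exists None; split=> [[u Au|//]|y _]; last exact: coprod_le0x.
by case: nA; exists u.
Qed.

End CoproductLattice.

Section CoproductSystem.
Context (d1 d2 : Order.disp_t) (S1 : sp_system d1) (S2 : sp_system d2).

Let Sigma : Type := (states S1 * states S2)%type.
Let L := coprod (properties S1) (properties S2).

Definition coproduct_xi (p : Sigma) : set L :=
  [set a | if a is Some u
           then xi S1 p.1 (val u).1 /\ xi S2 p.2 (val u).2 else False].

Definition coproduct_kappa (a : L) : set Sigma :=
  if a is Some u then kappa S1 (val u).1 `*` kappa S2 (val u).2 else set0.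

Fact coproduct_xi_kappa p a : coproduct_xi p a <-> coproduct_kappa a p.
Proof.
case: a => [u|//]; split=> -[h1 h2]; split; exact/xi_kappa.
Qed.

Definition coproduct_space : sp_space Sigma L := SPSpace coproduct_xi_kappa.

Lemma kappa_bot d (S : sp_system d) : kappa S \bot = set0.
Proof.
by rewrite predeqE => p; split=> // /(xi_kappa S) /(xi_bot S).
Qed.

Lemma kappa_neq0 d (S : sp_system d) (a : properties S) :
  a != \bot -> kappa S a !=set0.
Proof.
move=> a0; have [//|/set0P/negP/negPn/eqP k0] := pselect (kappa S a !=set0).
by move: a0; rewrite -lex0 => /negP[]; apply/property_leP; rewrite /property_le k0.
Qed.

Fact coproduct_leP (a b : L) : a <= b <-> property_le coproduct_space a b.
Proof.
rewrite coprod_leE /property_le.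
case: a => [u|] /=; last by split=> // _; exact: sub0set.
have /andP[/kappa_neq0[q1 k1] /kappa_neq0[q2 k2]] := valP u.
case: b => [v|] /=; last by split=> // /(_ (q1, q2)); case.
split=> [/andP[/property_leP l1 /property_leP l2] p [/l1 ? /l2 ?] //|le].
apply/andP; split; apply/property_leP => p kp.
  by case: (le (p, q2)).
by case: (le (q1, p)).
Qed.

Fact coproduct_xi_top p : coproduct_xi p \top.
Proof.
rewrite /coproduct_xi /= /Order.top /=; case: insubP => [u _ -> /=|].
  by split; apply: xi_top.
rewrite negb_and !negbK /= => /orP[] /eqP t0.
  by apply: (xi_bot S1 p.1); rewrite -t0; apply: xi_top.
by apply: (xi_bot S2 p.2); rewrite -t0; apply: xi_top.
Qed.

Fact coproduct_xi_bot p : ~ coproduct_xi p \bot.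
Proof. by []. Qed.

Fact coproduct_xi_inf p (A : set L) (m : L) : infimums A m ->
  (A `<=` coproduct_xi p <-> coproduct_xi p m).
Proof.
move=> im; split=> [Ap|pm a Aa]; last first.
  apply/coproduct_xi_kappa; have /coproduct_leP := im.1 _ Aa.
  by apply; apply/coproduct_xi_kappa.
have nA : ~ A None by move=> /Ap.
have [[m1 i1] _] := properties_complete S1 (coprod_fst A).
have [[m2 i2] _] := properties_complete S2 (coprod_snd A).
have -> : m = insub (m1, m2).
  have i12 := coprod_infimums nA i1 i2.
  by apply/le_anti/andP; split; [apply: i12.2 im.1|apply: im.2 i12.1].
have x1 : xi S1 p.1 m1.
  by apply/(xi_inf _ i1) => _ [u /Ap[? _] ->].
have x2 : xi S2 p.2 m2.
  by apply/(xi_inf _ i2) => _ [u /Ap[_ ?] ->].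
rewrite /coproduct_xi /=; case: insubP => [u _ -> //|].
rewrite negb_and !negbK /= => /orP[] /eqP m0; move: x1 x2; rewrite m0.
  by move=> /xi_bot.
by move=> _ /xi_bot.
Qed.

Definition coproduct : sp_system (coprod_display) :=
  @SPSystem _ Sigma L coproduct_space coproduct_leP
    (coprod_complete (properties_complete S1) (properties_complete S2))
    coproduct_xi_top coproduct_xi_bot coproduct_xi_inf.

End CoproductSystem.

(* Main.v *)
Require Import Defs.
From mathcomp Require Import all_boot all_order.
From mathcomp Require Import boolp.

(** If neither lattice is trivial, atomisticity yields in each [L_i] a
    nonzero element [a_i] and an atom [c_i] not below it. Then [(c_1, c_2)] is
    an atom of the co-product that meets [(a_1, a_2)] in 0, and
    [(a_1 `|` c_1, a_2)] lies strictly between [(a_1, a_2)] and its join with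
    [(c_1, c_2)]. *)

Set Implicit Arguments.
Unset Strict Implicit.
Unset Printing Implicit Defensive.

Import Order.Theory.

Local Open Scope order_scope.

(** Take [a] different from both bounds. If every atom were below [a], then so would be [\top], the
    supremum of all atoms. *)
Lemma atomistic_nontrivial d (L : tbLatticeType d) :
  atomistic L -> ~ trivial_lattice L ->
  exists a c : L, [/\ a != \bot, atom c & ~~ (c <= a)].
Proof.
move=> atL /existsNP[a /not_orP[/eqP a0 /eqP a1]].
apply: contrapT => noc; move/negP: a1; apply; rewrite -le1x.
apply: (atL \top).2 => c [atc _].
by apply: contrapT => /negP ca; apply: noc; exists a, c.
Qed.

Lemma atom_meet0 d (L : tbLatticeType d) (a c : L) :
  atom c -> ~~ (c <= a) -> a `&` c = \bot.
Proof.
move=> [_ minc] /negP ca; have [ac|//] := minc _ (leIr c a).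
by case: ca; rewrite -ac leIl.
Qed.

Section Coproduct.
Context (d1 d2 : Order.disp_t) (L1 : tbLatticeType d1) (L2 : tbLatticeType d2).

(** A pair [v] below [u] has nonzero components by its subtype proof, so minimality in each
    coordinate leaves only equality. *)
Lemma coprod_atom (u : nzpair L1 L2) :
  atom (val u).1 -> atom (val u).2 -> atom (Some u : coprod L1 L2).
Proof.
move=> [_ min1] [_ min2]; split=> // -[v|]; last by right.
move=> /andP[/min1 v1 /min2 v2]; left; congr Some; apply: val_inj.
have /andP[/eqP n1 /eqP n2] := valP v.
rewrite [LHS]surjective_pairing [RHS]surjective_pairing.
by case: v1 => // ->; case: v2 => // ->.
Qed.

Lemma covering_law_coprod :
  atomistic L1 -> atomistic L2 -> covering_law (coprod L1 L2) ->
  trivial_lattice L1 \/ trivial_lattice L2.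
Proof.
move=> at1 at2 cov; apply: contrapT.
move=> /not_orP[/(atomistic_nontrivial at1)[a1 [c1 [a10 atc1 ca1]]]].
move=> /(atomistic_nontrivial at2)[a2 [c2 [a20 atc2 ca2]]].
have ac10 : a1 `|` c1 != \bot.
  by apply: contraNneq a10 => e; rewrite -lex0 -e leUl.
have aP : (a1 != \bot) && (a2 != \bot) by rewrite a10.
have cP : (c1 != \bot) && (c2 != \bot).
  by apply/andP; split; apply/eqP; [case: atc1|case: atc2].
have bP : (a1 `|` c1 != \bot) && (a2 != \bot) by rewrite ac10.
pose a : coprod L1 L2 := Some (exist _ (a1, a2) aP).
pose b : coprod L1 L2 := Some (exist _ (a1 `|` c1, a2) bP).
pose c : coprod L1 L2 := Some (exist _ (c1, c2) cP).
have atc : atom c by apply: coprod_atom.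
have ac0 : a `&` c = \bot.
  by apply: atom_meet0 => //; rewrite coprod_leE /= (negbTE ca1).
have le_ab : a <= b by rewrite coprod_leE /= leUl lexx.
have le_b : b <= a `|` c.
  (* The join need not be computed: as an upper bound of [a] it is not [None], and the components of
     [v] bound those of [a] and [c]. *)
  have := lexx (a `|` c); rewrite leUx; case: (a `|` c) => [v|//].
  by rewrite !coprod_leE /= leUx => /andP[/andP[-> ->] /andP[-> _]].
(* The first alternative would force [c1 <= a1], the second [c2 <= a2]. *)
have [ab|bac] := cov c a b atc ac0 le_ab le_b.
  have : b <= a by rewrite ab.
  by rewrite coprod_leE /= leUx (negbTE ca1) andbF.
have : c <= b by rewrite bac leUr.
by rewrite coprod_leE /= (negbTE ca2) andbF.
Qed.

End Coproduct.

Theorem theorem18 (d1 d2 : Order.disp_t)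
    (S1 : sp_system d1) (S2 : sp_system d2) :
  atomistic (properties S1) ->
  atomistic (properties S2) ->
  covering_law (properties (coproduct S1 S2)) ->
  trivial_lattice (properties S1) \/ trivial_lattice (properties S2).
(* The property lattice of [coproduct S1 S2] unfolds to [coprod]. *)
Proof. exact: covering_law_coprod. Qed.
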